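(* Let $B$ be a Boolean algebra. The Stone's space $\mathrm{Hom}(B,\mathbb{Z}_2)$ is homeomorphic to $\mathcal{U}(B)$.
   Context: A Boolean algebra $(B,+,\cdot,\neg)$ is written with join $+$, meet $\cdot$ and complement $\neg$, with bottom $0$ and top $1$; $x\leqslant y$ means $x+y=y$. A homomorphism of Boolean algebras is a map preserving $+$, $\cdot$, $0$ and $1$. $\mathbb{Z}_2=\{0,1\}$ denotes the two-element Boolean algebra (so $1+1=1$, $\neg 0=1$, $\neg 1=0$). $\mathrm{Hom}(B,\mathbb{Z}_2)$ is the set of all Boolean algebra homomorphisms $B\to\mathbb{Z}_2$, with the subspace topology from $2^B=\{f:B\to\mathbb{Z}_2\}$, where $2^B$ is identified with $\prod_{x\in B}\mathbb{Z}_2$ carrying the product topology with $\mathbb{Z}_2$ discrete. A Stone's space is a compact Hausdorff totally disconnected space. A filter of $B$ is a nonempty subset $F\subset B$ closed under $\cdot$ and upward closed for $\leqslant$; it is proper if $F\neq B$. An ultrafilter of $B$ is a proper filter $F$ such that for every $x\in B$ exactly one of $x,\neg x$ lies in $F$. $\mathcal{U}(B)$ denotes the set of all ultrafilters of $B$, with the topology having as a basis the sets $U_x=\{F\in\mathcal{U}(B):x\in F\}$, $x\in B$. *)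

(* Defs.v *)
From HB Require Import structures.
From mathcomp Require Import all_boot all_order all_classical all_reals topology.

Set Implicit Arguments.
Unset Strict Implicit.
Unset Printing Implicit Defensive.

Import Order.Theory.
Local Open Scope classical_set_scope.

(* A Boolean algebra is a [ctbDistrLatticeType] (complemented distributive
   lattice with \bot and \top); the degenerate case \bot = \top is allowed.
   The two-element Boolean algebra is [bool], whose topology is discrete. *)

Definition boolean_hom d d' (B : ctbDistrLatticeType d)
    (C : ctbDistrLatticeType d') (f : B -> C) : Prop :=
  [/\ {morph f : x y / (x `|` y)%O}, {morph f : x y / (x `&` y)%O},
      f \bot%O = \bot%O & f \top%O = \top%O].

(* [{ptws B -> bool}] is 2^B with the product topology, and [set_type] carries
   the induced (initial) topology along the inclusion. *)
Definition HomZ2 d (B : ctbDistrLatticeType d) : topologicalType :=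
  set_type [set f : {ptws B -> bool} | boolean_hom f].

Definition boolean_filter d (B : ctbDistrLatticeType d) (F : set B) : Prop :=
  [/\ F !=set0, forall x y, F x -> F y -> F (x `&` y)%O
    & forall x y, F x -> (x <= y)%O -> F y].

Definition boolean_ultrafilter d (B : ctbDistrLatticeType d)
    (F : set B) : Prop :=
  [/\ boolean_filter F, F <> [set: B]
    & forall x, (F x /\ ~ F (~` x)%O) \/ (~ F x /\ F (~` x)%O)].

Definition ultrafilters d (B : ctbDistrLatticeType d) : Type :=
  set_type [set F : set B | boolean_ultrafilter F].

HB.instance Definition _ d (B : ctbDistrLatticeType d) :=
  Choice.copy (ultrafilters B) (set_type [set F : set B | boolean_ultrafilter F]).

Definition ultra_basic d (B : ctbDistrLatticeType d) (x : B) :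
    set (ultrafilters B) := [set F | (set_val F : set B) x].

Lemma ultra_basic_cover d (B : ctbDistrLatticeType d) :
  \bigcup_(U in range (@ultra_basic d B)) U = [set: ultrafilters B].
Proof.
apply/seteqP; split=> // F _.
have [[[x Fx] _ _] _ _] := set_mem (valP F).
by exists (ultra_basic x) => //; exists x.
Qed.

Lemma ultra_basic_join d (B : ctbDistrLatticeType d)
    (U V : set (ultrafilters B)) (F : ultrafilters B) :
  range (@ultra_basic d B) U -> range (@ultra_basic d B) V -> U F -> V F ->
  exists W, [/\ range (@ultra_basic d B) W, W F & W `<=` U `&` V].
Proof.
move=> [x _ <-] [y _ <-] Fx Fy; exists (ultra_basic (x `&` y)%O); split.
- by exists (x `&` y)%O.
- by have [[_ FI _] _ _] := set_mem (valP F); exact: FI.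
- move=> G Gxy; have [[_ _ GS] _ _] := set_mem (valP G).
  by split; apply: (GS _ _ Gxy); [exact: leIl | exact: leIr].
Qed.

HB.instance Definition _ d (B : ctbDistrLatticeType d) :=
  isBaseTopological.Build (ultrafilters B)
    (@ultra_basic_cover d B) (@ultra_basic_join d B).

Definition stone_space (X : topologicalType) : Prop :=
  [/\ compact [set: X], hausdorff_space X & totally_disconnected [set: X]].

Definition homeomorphic (X Y : topologicalType) : Prop :=
  exists (f : X -> Y) (g : Y -> X),
    [/\ cancel f g, cancel g f, continuous f & continuous g].

(* Main.v *)
Require Import Defs.
From HB Require Import structures.
From mathcomp Require Import all_boot all_order all_classical all_reals topology.

(** A homomorphism [f : B -> bool] is the indicator function of the set
    [f @^-1` [set true]], and the homomorphism equations for [f] say precisely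
    that this set is an ultrafilter ([ultrafilter_of_hom], [hom_of_ultrafilter]).
    The two topologies also match: the evaluations [f |-> f x] are continuous on
    Hom(B, Z_2), and the fibre over [true] of the evaluation at [x] corresponds
    to the basic open set [ultra_basic x], which gives continuity in one
    direction.  In the other direction a map into a subspace of a product is
    continuous as soon as its coordinates are, and the coordinate at [x] is the
    indicator of [ultra_basic x]; it is locally constant because the complement of
    [ultra_basic x] is [ultra_basic (~` x)].

    Compactness comes from Tychonoff's theorem: 2^B is compact, and the
    homomorphisms form a closed subset since each equation involves at most
    three coordinates ([closed_boolean_hom]).  Separation and total
    disconnectedness both follow from the fact that two distinct homomorphisms
    differ at some [x], so that a fibre of the evaluation at [x] is a clopen set
    separating them ([zero_dimensional_HomZ2]). *)

Set Implicit Arguments.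
Unset Strict Implicit.
Unset Printing Implicit Defensive.

Import Order.Theory.
Local Open Scope classical_set_scope.

(** * Subspaces and zero-dimensional spaces *)

(** A filter on the subtype is pushed forward to the ambient space, where it has
    a cluster point in [A]; as open sets of the subtype are traces of open sets,
    that point is a cluster point of the original filter. *)
Lemma compact_set_type (X : topologicalType) (A : set X) :
  compact A -> compact [set: set_type A].
Proof.
move=> cptA F PF _.
have FA : (set_val @ F) A.
  by rewrite /fmap /=; apply: filterE => a; exact: set_valP.
have [p [Ap clp]] := cptA _ (fmap_proper_filter _ PF) FA.
exists (exist _ p (mem_set Ap)); split=> // S W FS [_ [[V oV <-] /= Vp VW]].
have FvS : (set_val @ F) (set_val @` S).
  by rewrite /fmap /=; apply: filterS FS => s Ss; exists s.
have [_ [[s Ss <-] Vs]] := clp _ _ FvS (open_nbhs_nbhs (conj oV Vp)).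
by exists s; split=> //; exact: VW.
Qed.

Lemma zero_dimensional_hausdorff (X : topologicalType) :
  zero_dimensional X -> hausdorff_space X.
Proof.
move=> zdX x y clxy; apply: contrapT => /eqP/zdX[U [[oU cU] Ux nUy]].
have [z [Uz]] :=
  clxy _ _ (open_nbhs_nbhs (conj oU Ux))
           (open_nbhs_nbhs (conj (closed_openC cU) nUy)).
by apply.
Qed.

(** * Evaluations on Hom(B, Z_2) *)

Section HomZ2_topology.
Context (d : Order.disp_t) (B : ctbDistrLatticeType d).

Lemma near_ptws_bool (f : {ptws B -> bool}) (x : B) :
  \forall g \near f, g x = f x.
Proof.
apply: (@proj_continuous B (fun=> bool) x f [set f x]).
by apply: open_nbhs_nbhs; split=> //; exact: discrete_open.
Qed.

(** Every neighbourhood of a point [f] of the closure contains a homomorphism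
    agreeing with [f] at the coordinates of the equation considered, so [f]
    satisfies that equation. *)
Lemma closed_boolean_hom :
  closed [set f : {ptws B -> bool} | boolean_hom f].
Proof.
move=> f clf; split.
- move=> x y.
  have [g [[gU _ _ _] [<- [<- <-]]]] := clf _ (filterI
    (near_ptws_bool f (x `|` y)%O)
    (filterI (near_ptws_bool f x) (near_ptws_bool f y))).
  exact: gU.
- move=> x y.
  have [g [[_ gI _ _] [<- [<- <-]]]] := clf _ (filterI
    (near_ptws_bool f (x `&` y)%O)
    (filterI (near_ptws_bool f x) (near_ptws_bool f y))).
  exact: gI.
- by have [g [[_ _ g0 _] <-]] := clf _ (near_ptws_bool f \bot%O).
- by have [g [[_ _ _ g1] <-]] := clf _ (near_ptws_bool f \top%O).
Qed.

Lemma compact_HomZ2 : compact [set: HomZ2 B].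
Proof.
have cpt2B := @tychonoff B (fun=> bool) (fun=> setT) (fun=> bool_compact).
by apply/compact_set_type/(subclosed_compact closed_boolean_hom cpt2B) => f _ x.
Qed.

Definition hom_fun (f : HomZ2 B) : B -> bool := set_val f.

Lemma hom_funP (f : HomZ2 B) : boolean_hom (hom_fun f).
Proof. exact: set_mem (valP f). Qed.

Lemma hom_fun_continuous (x : B) : continuous (hom_fun ^~ x).
Proof.
move=> f.
apply: (@continuous_comp (HomZ2 B) {ptws B -> bool} bool set_val (@^~ x)).
  exact: initial_continuous.
exact: (@proj_continuous B (fun=> bool) x).
Qed.

Lemma clopen_hom_fiber (x : B) (b : bool) :
  clopen [set f : HomZ2 B | hom_fun f x = b].
Proof.
have clb : clopen [set b].
  split; first exact: discrete_open.
  exact: discrete_closed.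
exact: preimage_clopen clb (hom_fun_continuous (x := x)).
Qed.

Lemma zero_dimensional_HomZ2 : zero_dimensional (HomZ2 B).
Proof.
move=> f g /eqP fg.
have [x fgx] : exists x, hom_fun f x <> hom_fun g x.
  by apply/existsNP => fg_eq; apply/fg/val_inj/funext.
exists [set h | hom_fun h x = hom_fun f x].
by split=> [||/esym//]; first exact: clopen_hom_fiber.
Qed.

Lemma stone_space_HomZ2 : stone_space (HomZ2 B).
Proof.
split; first exact: compact_HomZ2.
  exact/zero_dimensional_hausdorff/zero_dimensional_HomZ2.
exact/zero_dimension_totally_disconnected/zero_dimensional_HomZ2.
Qed.

End HomZ2_topology.

(** * Homomorphisms as indicators of ultrafilters *)

Section hom_ultrafilter.
Context (d : Order.disp_t) (B : ctbDistrLatticeType d).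

(** The complement clause is [f x || f (~` x)] and [~~ (f x && f (~` x))], the
    images under [f] of [x `|` ~` x = \top] and [x `&` ~` x = \bot]. *)
Lemma ultrafilter_of_hom (f : B -> bool) :
  boolean_hom f -> boolean_ultrafilter [set x | f x].
Proof.
move=> [fU fI f0 f1]; split; first split.
- by exists \top%O; rewrite /= f1.
- by move=> x y /= fx fy; rewrite fI fx fy.
- by move=> x y /= fx /meet_idPl xy; move: fx; rewrite -xy fI => /andP[].
- by move=> /seteqP[_ /(_ \bot%O I)] /=; rewrite f0.
- move=> x /=; have := fU x (~` x)%O; have := fI x (~` x)%O.
  rewrite joinxC meetxC f0 f1.
  by case: (f x) (f (~` x)%O) => [] [] //= _ _; [left | right]; split.
Qed.

(** Preservation of joins is where the complement enters: if neither [x] nor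
    [y] is in [F], then [F] contains [~` x `&` ~` y = ~` (x `|` y)],
    hence not [x `|` y]. *)
Lemma hom_of_ultrafilter (F : set B) :
  boolean_ultrafilter F -> boolean_hom (fun x => `[<F x>]).
Proof.
move=> [[[a Fa] FI FS] FnT FC]; split.
- move=> x y; apply/asboolP/orP => [Fxy|[] /asboolP]; last 2 first.
  + by move/FS; apply; exact: leUl.
  + by move/FS; apply; exact: leUr.
  have [[Fx _]|[_ nFx]] := FC x; first by left; exact/asboolP.
  have [[Fy _]|[_ nFy]] := FC y; first by right; exact/asboolP.
  have [[_ []]|[//]] := FC (x `|` y)%O.
  by rewrite complU; exact: FI.
- move=> x y; apply/asboolP/andP => [Fxy|[/asboolP Fx /asboolP Fy]].
    by split; apply/asboolP; apply: FS Fxy _; [exact: leIl | exact: leIr].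
  exact: FI.
- apply/asboolP => F0; apply: FnT; apply/seteqP; split=> // x _.
  by apply: FS F0 _; exact: le0x.
- by apply/asboolP; apply: FS Fa _; exact: lex1.
Qed.

Definition hom_to_ultra (f : HomZ2 B) : ultrafilters B :=
  SigSub (mem_set (ultrafilter_of_hom (hom_funP f))).

Lemma ultrafiltersP (F : ultrafilters B) :
  boolean_ultrafilter (set_val F : set B).
Proof. exact: set_mem (valP F). Qed.

Definition ultra_to_hom (F : ultrafilters B) : HomZ2 B :=
  SigSub (mem_set (hom_of_ultrafilter (ultrafiltersP F))).

Lemma hom_to_ultraK : cancel hom_to_ultra ultra_to_hom.
Proof. by move=> f; apply/val_inj/funext => x; exact: asboolb. Qed.

Lemma ultra_to_homK : cancel ultra_to_hom hom_to_ultra.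
Proof.
move=> F; apply/val_inj/seteqP; split=> x /= => [/asboolP //|Fx].
exact/asboolP.
Qed.

Lemma open_ultra_basic (x : B) : open (@ultra_basic d B x).
Proof.
exists [set ultra_basic x]; first by move=> _ ->; exists x.
by rewrite bigcup_set1.
Qed.

Lemma hom_to_ultra_continuous : continuous hom_to_ultra.
Proof.
apply/continuousP => _ [D Dbasic <-]; rewrite preimage_bigcup.
apply: bigcup_open => U /Dbasic[x _ <-].
by have [] := clopen_hom_fiber x true.
Qed.

(** If [x] is not in [F], then [~` x] is, and [ultra_basic (~` x)] is a
    neighbourhood of [F] whose members all avoid [x]. *)
Lemma near_ultra_to_hom (F : ultrafilters B) (x : B) :
  \forall G \near F, hom_fun (ultra_to_hom G) x = hom_fun (ultra_to_hom F) x.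
Proof.
have [_ _ /(_ x)[[Fx _]|[nFx FCx]]] := ultrafiltersP F.
  have /open_nbhs_nbhs : open_nbhs F (ultra_basic x).
    by split=> //; exact: open_ultra_basic.
  by apply: filterS => G Gx; apply: asbool_equiv_eq; split.
have /open_nbhs_nbhs : open_nbhs F (ultra_basic (~` x)%O).
  by split=> //; exact: open_ultra_basic.
apply: filterS => G GCx; apply: asbool_equiv_eq; split=> // Gx.
by have [_ _ /(_ x)[[_ []]|[]]] := ultrafiltersP G.
Qed.

Lemma ultra_to_hom_continuous : continuous ultra_to_hom.
Proof.
apply: continuous_comp_initial => F.
have filterF : Filter ((set_val \o ultra_to_hom) @ F).
  exact/fmap_filter/nbhs_filter.
apply/cvg_sup => x.
apply: (@continuous_comp_initial _ _ _ (fun f : B -> bool => f x)) => G U /=.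
move=> /nbhs_singleton UGx; apply: filterS (near_ultra_to_hom G x) => H Hx.
by rewrite /preimage /= -[X in U X]/(hom_fun (ultra_to_hom H) x) Hx.
Qed.

End hom_ultrafilter.

Theorem theorem3p32 (d : Order.disp_t) (B : ctbDistrLatticeType d) :
  stone_space (HomZ2 B) /\ homeomorphic (HomZ2 B) (ultrafilters B).
Proof.
split; first exact: stone_space_HomZ2.
exists (@hom_to_ultra d B), (@ultra_to_hom d B); split.
- exact: hom_to_ultraK.
- exact: ultra_to_homK.
- exact: hom_to_ultra_continuous.
- exact: ultra_to_hom_continuous.
Qed.
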